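(* Let $(\mathbf{A}_1,p_1,\phi_1),\ldots,(\mathbf{A}_m,p_m,\phi_m)$ be a finite collection of categorical probabilistic triples and let $(\lambda_1,\ldots,\lambda_m)$ be a probability vector. Let $(\mathbf{m},\Lambda,\delta)$ be the categorical probabilistic triple where $\mathbf{m}$ is the finite discrete category of cardinality $m$, with objects $\{x_1,\ldots,x_m\}$, $\Lambda(x_i)=\lambda_i$, and $\delta$ is the Kronecker delta. Then $$\mathcal{H}\left(\bigoplus_{i=1}^m\lambda_i(\mathbf{A}_i,p_i,\phi_i)\right)=\sum_{i=1}^m\lambda_i\,\mathcal{H}(\mathbf{A}_i,p_i,\phi_i)+\mathcal{H}(\mathbf{m},\Lambda,\delta).$$
   Context: A categorical probabilistic triple $(\mathbf{A},p,\phi)$ consists of (1) a finite category $\mathbf{A}$; (2) a probability $p$ on the finite set $\operatorname{Ob}(\mathbf{A})$; (3) a function $\phi:\operatorname{Ob}(\mathbf{A})\times\operatorname{Ob}(\mathbf{A})\to[0,\infty)$ such that $\phi(a,a)>0$ for all objects $a$, and $\phi(b,b')=0$ whenever there is no arrow from $b$ to $b'$ in $\mathbf{A}$. The categorical entropy of a triple is $$\mathcal{H}(\mathbf{A},p,\phi):=-\sum_{a\in\operatorname{Ob}(\mathbf{A})}p(a)\ln\Big(\sum_{b\in\operatorname{Ob}(\mathbf{A})}p(b)\phi(a,b)\Big),$$ with the convention that the summand indexed by $a$ is $0$ whenever $p(a)=0$. A discrete category is one with only identity arrows. The Kronecker delta is $\delta(x,x)=1$ and $\delta(x,y)=0$ for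 $x\neq y$. For triples $(\mathbf{A}_i,p_i,\phi_i)$, $i=1,\dots,m$, and a probability vector $(\lambda_1,\dots,\lambda_m)$ (nonnegative entries summing to $1$), define $$\bigoplus_{i=1}^m\lambda_i(\mathbf{A}_i,p_i,\phi_i)=\left(\coprod_{i=1}^m\mathbf{A}_i,\ \bigoplus_{i=1}^m\lambda_ip_i,\ \bigoplus_{i=1}^m\phi_i\right),$$ where $\coprod$ is the disjoint union of categories, $\left(\bigoplus_{i=1}^m\lambda_ip_i\right)(x)=\lambda_ip_i(x)$ for $x\in\operatorname{Ob}(\mathbf{A}_i)$, and $\left(\bigoplus_{i=1}^m\phi_i\right)(x,y)=\phi_i(x,y)$ if $x,y\in\operatorname{Ob}(\mathbf{A}_i)$ for some $i$, and $0$ otherwise. *)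

(* Defs.v *)
From HB Require Import structures.
From mathcomp Require Import all_boot all_order all_algebra.
From mathcomp Require Import reals exp.

Set Implicit Arguments.
Unset Strict Implicit.
Unset Printing Implicit Defensive.

Import Order.TTheory GRing.Theory Num.Theory.
Local Open Scope ring_scope.

Record fincat := FinCat {
  ob :> finType;
  hom : ob -> ob -> finType;
  idm : forall a : ob, hom a a;
  compm : forall a b c : ob, hom b c -> hom a b -> hom a c;
  comp1m : forall (a b : ob) (f : hom a b), compm (idm b) f = f;
  compm1 : forall (a b : ob) (f : hom a b), compm f (idm a) = f;
  compA : forall (a b c d : ob) (h : hom c d) (g : hom b c) (f : hom a b),
    compm h (compm g f) = compm (compm h g) f
}.
Arguments hom {f0} _ _ : rename.
Arguments idm {f0} a : rename.
Arguments compm {f0 a b c} _ _ : rename.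

Section DiscreteCategory.
Variable T : finType.

(* One arrow when [x = y], none otherwise. *)
Definition disc_hom (x y : T) : finType := {_ : unit | x == y}.

Definition disc_id (x : T) : disc_hom x x := exist _ tt (eqxx x).

Definition disc_comp (x y z : T) (g : disc_hom y z) (f : disc_hom x y) :
    disc_hom x z :=
  exist _ tt (introT eqP (etrans (eqP (valP f)) (eqP (valP g)))).

Lemma disc_hom_irr (x y : T) (f g : disc_hom x y) : f = g.
Proof. by apply: val_inj; case: (val f); case: (val g). Qed.

Definition discrete : fincat :=
  @FinCat T disc_hom disc_id disc_comp
    (fun _ _ _ => disc_hom_irr _ _) (fun _ _ _ => disc_hom_irr _ _)
    (fun _ _ _ _ _ _ _ => disc_hom_irr _ _).

End DiscreteCategory.

Lemma ecast_esymK (T : Type) (P : T -> Type) (x y : T) (e : x = y) (p : P y) :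
  ecast z (P z) e (ecast z (P z) (esym e) p) = p.
Proof. by case: y / e p. Qed.

Lemma ecast_esymKV (T : Type) (P : T -> Type) (x y : T) (e : x = y) (p : P x) :
  ecast z (P z) (esym e) (ecast z (P z) e p) = p.
Proof. by case: y / e. Qed.

Section Coproduct.
Variables (I : finType) (A : I -> fincat).

Definition coprod_ob : finType := {i : I & A i}.

(* [tagged_as x y] is [tagged y] seen in the summand of [x] when
   [tag x = tag y]; its junk value otherwise is discarded by the condition,
   so that there are no arrows between distinct summands. *)
Definition coprod_hom (x y : coprod_ob) : finType :=
  {_ : hom (tagged x) (tagged_as x y) | tag x == tag y}.

Definition coprod_in (i : I) (a b : A i) (f : hom a b) :
    coprod_hom (Tagged A a) (Tagged A b) :=
  exist _ (ecast b' (hom a b') (esym (tagged_asE (u := Tagged A a) b)) f)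
    (eqxx i).

Definition coprod_out (i : I) (a b : A i)
    (f : coprod_hom (Tagged A a) (Tagged A b)) : hom a b :=
  ecast b' (hom a b') (tagged_asE (u := Tagged A a) b) (val f).

Lemma coprod_inK (i : I) (a b : A i) :
  cancel (@coprod_in i a b) (@coprod_out i a b).
Proof.
move=> f; rewrite /coprod_out /=.
exact: (ecast_esymK (P := fun b' : A i => hom a b')).
Qed.

Lemma coprod_outK (i : I) (a b : A i) :
  cancel (@coprod_out i a b) (@coprod_in i a b).
Proof.
move=> f; apply: val_inj; rewrite /= /coprod_out.
exact: (ecast_esymKV (P := fun b' : A i => hom a b')).
Qed.

Definition coprod_id (x : coprod_ob) : coprod_hom x x :=
  let: existT i a := x in coprod_in (idm a).

Definition coprod_comp_cast (x y z : coprod_ob) :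
  tag x = tag y -> tag y = tag z ->
  coprod_hom y z -> coprod_hom x y -> coprod_hom x z.
Proof.
case: x y z => [i a] [j b] [k c] /= eij ejk.
case: k / ejk c => c; case: j / eij b c => b c g f.
exact: coprod_in (compm (coprod_out g) (coprod_out f)).
Defined.

Definition coprod_comp (x y z : coprod_ob) (g : coprod_hom y z)
    (f : coprod_hom x y) : coprod_hom x z :=
  coprod_comp_cast (eqP (valP f)) (eqP (valP g)) g f.

Lemma coprod_compE (i : I) (a b c : A i) (g : hom b c) (f : hom a b) :
  coprod_comp (coprod_in g) (coprod_in f) = coprod_in (compm g f).
Proof.
rewrite /coprod_comp; move: (eqP (valP (coprod_in f))).
move: (eqP (valP (coprod_in g))) => /= e e'.
by rewrite (eq_axiomK e) (eq_axiomK e') /= !coprod_inK.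
Qed.

Lemma coprod_homP (P : forall x y, coprod_hom x y -> Prop) :
  (forall i (a b : A i) (f : hom a b), P _ _ (coprod_in f)) ->
  forall x y (f : coprod_hom x y), P x y f.
Proof.
move=> Pin [i a] [j b] f; have eij : i = j := eqP (valP f).
move: eij b f => /= eij; case: j / eij => b f.
by rewrite -(coprod_outK f); exact: Pin.
Qed.

Lemma coprod_comp1m (x y : coprod_ob) (f : coprod_hom x y) :
  coprod_comp (coprod_id y) f = f.
Proof.
by move: x y f; apply: coprod_homP => i a b f; rewrite coprod_compE comp1m.
Qed.

Lemma coprod_compm1 (x y : coprod_ob) (f : coprod_hom x y) :
  coprod_comp f (coprod_id x) = f.
Proof.
by move: x y f; apply: coprod_homP => i a b f; rewrite coprod_compE compm1.
Qed.

Lemma coprod_compA (x y z t : coprod_ob) (h : coprod_hom z t)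
    (g : coprod_hom y z) (f : coprod_hom x y) :
  coprod_comp h (coprod_comp g f) = coprod_comp (coprod_comp h g) f.
Proof.
case: x y z t f g h => [i a] [j b] [k c] [l d] f g h.
have eij : i = j := eqP (valP f); case: j / eij b f g => b f g.
have eik : i = k := eqP (valP g); case: k / eik c g h => c g h.
have eil : i = l := eqP (valP h); case: l / eil d h => d h.
rewrite -(coprod_outK f) -(coprod_outK g) -(coprod_outK h).
by rewrite !coprod_compE compA.
Qed.

Definition coprod : fincat :=
  FinCat coprod_comp1m coprod_compm1 coprod_compA.

End Coproduct.

Record fprob (R : realType) (T : finType) := FProb {
  prob_fun :> T -> R;
  prob_ge0 : forall a, 0 <= prob_fun a;
  prob_sum1 : \sum_a prob_fun a = 1
}.

Record triple (R : realType) := Triple {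
  tcat : fincat;
  pr : fprob R tcat;
  phi : tcat -> tcat -> R;
  phi_ge0 : forall a b, 0 <= phi a b;
  phi_diag : forall a, 0 < phi a a;
  phi_nohom : forall b b' : tcat, (hom b b' -> False) -> phi b b' = 0
}.
Arguments pr {R} t.
Arguments phi {R} t _ _.

(* The logarithm is only evaluated where its argument is positive: if
   [pr t a != 0], the argument is at least [pr t a * phi t a a]. *)
Definition entropy (R : realType) (t : triple R) : R :=
  - \sum_(a : tcat t | pr t a != 0)
      pr t a * ln (\sum_(b : tcat t) pr t b * phi t a b).

Section DiscreteTriple.
Variables (R : realType) (T : finType) (p : fprob R T).

Definition kronecker (x y : discrete T) : R := (x == y)%:R.

Lemma kronecker_ge0 x y : 0 <= kronecker x y.
Proof. exact: ler0n. Qed.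

Lemma kronecker_diag x : 0 < kronecker x x.
Proof. by rewrite /kronecker eqxx ltr01. Qed.

Lemma kronecker_nohom (x y : discrete T) :
  (hom x y -> False) -> kronecker x y = 0.
Proof.
rewrite /kronecker; case: eqP => [-> noh|//].
by case: (noh (idm y)).
Qed.

Definition discrete_triple : triple R :=
  @Triple R (discrete T) p kronecker
    kronecker_ge0 kronecker_diag kronecker_nohom.

End DiscreteTriple.

Section SumTriple.
Variables (R : realType) (I : finType).
Variables (lambda : fprob R I) (t : I -> triple R).

Local Notation C := (coprod (fun i => tcat (t i))).

Definition sum_pr_fun (x : C) : R := lambda (tag x) * pr (t (tag x)) (tagged x).

Lemma sum_pr_ge0 x : 0 <= sum_pr_fun x.
Proof. by rewrite mulr_ge0 ?prob_ge0. Qed.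

Lemma sum_pr_sum1 : \sum_x sum_pr_fun x = 1.
Proof.
rewrite -(prob_sum1 lambda).
transitivity (\sum_i \sum_(a : tcat (t i)) lambda i * pr (t i) a).
  by rewrite sig_big_dep.
by apply: eq_bigr => i _; rewrite -mulr_sumr prob_sum1 mulr1.
Qed.

Definition sum_pr : fprob R C := FProb sum_pr_ge0 sum_pr_sum1.

Definition sum_phi (x y : C) : R :=
  if tag x == tag y then phi (t (tag x)) (tagged x) (tagged_as x y) else 0.

Lemma sum_phi_ge0 x y : 0 <= sum_phi x y.
Proof. by rewrite /sum_phi; case: ifP => // _; apply: phi_ge0. Qed.

Lemma sum_phi_diag x : 0 < sum_phi x x.
Proof. by case: x => i a; rewrite /sum_phi eqxx tagged_asE; apply: phi_diag. Qed.

Lemma sum_phi_nohom (x y : C) : (hom x y -> False) -> sum_phi x y = 0.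
Proof.
move=> noh; rewrite /sum_phi; case: ifP => // exy.
by apply: phi_nohom => f; apply: noh; exists f.
Qed.

Definition sum_triple : triple R :=
  @Triple R C sum_pr sum_phi sum_phi_ge0 sum_phi_diag sum_phi_nohom.

End SumTriple.

(* Main.v *)
Require Import Defs.
From mathcomp Require Import all_boot all_order all_algebra.
From mathcomp Require Import reals exp.

Import Order.TTheory GRing.Theory Num.Theory.
Local Open Scope ring_scope.

(** Since [sum_phi] vanishes between distinct summands, the mean of
    [sum_phi] seen from an object [a] of the [i]-th summand is [lambda i]
    times the mean of [phi (t i)] seen from [a] ([mean_sum_triple]).  The
    logarithm turns this product into a sum.  Weighted by
    [lambda i * pr (t i) a] and summed over [a] and [i], the term
    [ln (mean (t i) a)] contributes the average of the entropies, and the term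
    [ln (lambda i)], constant on the [i]-th summand whose total weight is
    [lambda i], contributes the Shannon entropy of [lambda], which is the
    entropy of the discrete triple.

    Splitting the logarithm needs both factors to be positive.  This can
    fail only where the weight in front of the logarithm is zero
    ([mean_gt0]), and there both sides vanish. *)

Definition mean {R : realType} (t : triple R) (a : tcat t) : R :=
  \sum_(b : tcat t) pr t b * phi t a b.

(** Objects of probability zero have zero weight anyway, so the sum can range
    over all objects and be reindexed freely. *)
Lemma entropyE (R : realType) (t : triple R) :
  entropy t = - \sum_(a : tcat t) pr t a * ln (mean t a).
Proof.
rewrite /entropy big_mkcond /=; congr (- _); apply: eq_bigr => a _.
by case: eqP => //= ->; rewrite mul0r.
Qed.

(** The diagonal term alone is positive, because [phi t a a] is. *)
Lemma mean_gt0 (R : realType) (t : triple R) (a : tcat t) :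
  pr t a != 0 -> 0 < mean t a.
Proof.
move=> pa; rewrite /mean (bigD1 a) //= ltr_wpDr //.
  by apply: sumr_ge0 => b _; rewrite mulr_ge0 ?prob_ge0 ?phi_ge0.
by rewrite mulr_gt0 ?phi_diag // lt_def pa prob_ge0.
Qed.

Lemma mean_discrete_triple (R : realType) (T : finType) (p : fprob R T)
    (x : T) :
  mean (discrete_triple p) x = p x.
Proof.
rewrite /mean (bigD1 x) //= /kronecker eqxx mulr1 big1 ?addr0 // => y.
by rewrite eq_sym => /negPf ->; rewrite mulr0.
Qed.

Lemma big_coprod (R : realType) (I : finType) (A : I -> fincat)
    (F : coprod A -> R) :
  \sum_(x : coprod A) F x = \sum_(i : I) \sum_(a : A i) F (Tagged A a).
Proof.
rewrite (sig_big_dep (fun _ => true) (fun _ _ => true)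
           (fun i (a : A i) => F (Tagged A a))) /=.
by apply: eq_bigr => -[].
Qed.

Lemma mean_sum_triple (R : realType) (I : finType) (lambda : fprob R I)
    (t : I -> triple R) (i : I) (a : tcat (t i)) :
  mean (sum_triple lambda t) (Tagged (fun j => tcat (t j)) a) =
  lambda i * mean (t i) a.
Proof.
rewrite /mean big_coprod (bigD1 i) //= [X in _ + X]big1 ?addr0 => [|j ji].
  rewrite mulr_sumr; apply: eq_bigr => b _.
  by rewrite /sum_pr_fun /sum_phi /= eqxx tagged_asE mulrA.
rewrite big1 // => b _.
by rewrite /sum_phi /= eq_sym (negPf ji) mulr0.
Qed.

Theorem proposition4 (R : realType) (m : nat) (t : 'I_m -> triple R)
    (lambda : fprob R 'I_m) :
  entropy (sum_triple lambda t) =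
  \sum_(i < m) lambda i * entropy (t i) + entropy (discrete_triple lambda).
Proof.
rewrite !entropyE big_coprod -!sumrN -big_split /=; apply: eq_bigr => i _.
rewrite mean_discrete_triple entropyE mulrN -opprD; congr (- _).
(* The total weight 1 of [pr (t i)] spreads the entropy term of [lambda i]
   over the objects of the summand, so that both sides compare termwise. *)
rewrite -[lambda i * ln _]mul1r -(prob_sum1 (pr (t i))) mulr_suml mulr_sumr.
rewrite -big_split /=; apply: eq_bigr => a _.
rewrite mean_sum_triple /sum_pr_fun /=.
have [->|li] := eqVneq (lambda i) 0; first by rewrite !mul0r mulr0 addr0.
have [->|pa] := eqVneq (pr (t i) a) 0; first by rewrite mulr0 !mul0r mulr0 addr0.
rewrite lnM ?posrE ?mean_gt0 ?lt_def ?li ?prob_ge0 //.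
by rewrite mulrDr addrC -!mulrA [in RHS](mulrCA (pr (t i) a)).
Qed.
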